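(* For every $m\in\mathbb{N}$ there exists a natural number $C'=C'(m)$ such that for every colouring $\Delta:\mathbb{N}_1\times\mathbb{N}_2\rightarrow\mathbb{N}$ of the edges of the complete bipartite graph between two copies $\mathbb{N}_1,\mathbb{N}_2$ of $\mathbb{N}$ that uses at least $C'$ distinct colours, there exist $X\subset\mathbb{N}_1$ and $Y\subset\mathbb{N}_2$ such that the edges of the complete bipartite graph between $X$ and $Y$ use exactly $m$ distinct colours, i.e. $|\Delta(X\times Y)|=m$. *)

(* Defs.v *)
From mathcomp Require Export all_boot all_classical.

(* Main.v *)
Require Import Defs.
From mathcomp Require Import finmap.
Local Open Scope classical_set_scope.
Local Open Scope card_scope.

(* If some row or column has at least [m] colours, a subset of it has exactly [m].
   Otherwise every row and column has fewer than [m] colours, while there are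
   many edges [(x_i, y_i)] of pairwise distinct colours [c_i]. A Ramsey argument,
   in which local boundedness replaces a bounded total number of colours, extracts
   a subsequence along which [(x_i, y_j)] has colour [a] for [i < j] and [b] for
   [i > j]. After discarding the at most two [i] with [c_i] in [{a, b}], a
   submatrix with [k] diagonal entries has exactly [k + #|{a, b}|] colours. *)

Lemma pigeonhole (T C : eqType) (F : T -> C) (n : nat) (u : seq C) (s : seq T) :
  {in s, forall x, F x \in u} -> size u * n < size s ->
  exists c, n < size [seq x <- s | F x == c].
Proof.
elim: u s => [|c u IHu] s Fs ltns.
  by case: s Fs ltns => //= x s /(_ x); rewrite in_cons eqxx => /(_ isT).
have [nc|cn] := ltnP n (size [seq x <- s | F x == c]); first by exists c.
have [||d nd] := IHu [seq x <- s | F x != c].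
- by move=> x; rewrite mem_filter => /andP[/negPf Fxc /Fs]; rewrite in_cons Fxc.
- rewrite size_filter -(ltn_add2l (count (fun x => F x == c) s)) count_predC.
  by apply: leq_ltn_trans ltns; rewrite /= mulSn leq_add2r -size_filter.
exists d; apply: leq_trans nd _.
by rewrite -filter_predI !size_filter sub_count // => x /= /andP[].
Qed.

(** Greedy choice: the head [x] sees at most [k] colours on the tail, so many later elements share
    one colour [c]; record [(x, c)] and continue inside that class. Only the colours seen from a
    single element are counted, so [N] depends on [k] and [n] alone. *)
Lemma end_homogeneous (k n : nat) : exists N, forall (T C : eqType) (q : T -> T -> C),
  (forall x s, size (undup [seq q x y | y <- s]) <= k) ->
  forall s, N <= size s -> exists t : seq (T * C),
    [/\ subseq (unzip1 t) s, size t = n &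
        pairwise (fun p p' => q p.1 p'.1 == p.2) t].
Proof.
elim: n => [|n [N IHn]].
  by exists 0 => T C q _ s _; exists [::]; split=> //; apply: sub0seq.
(* One unit pays for the head, the other for the strict inequality in [pigeonhole]. *)
exists (k * N).+2 => T C q qk [//|x s]; rewrite ltnS => ltNs.
have [||c Nc] := @pigeonhole T C (q x) N (undup [seq q x y | y <- s]) s.
- by move=> y ys; rewrite mem_undup map_f.
- by apply: leq_ltn_trans ltNs; rewrite leq_mul2r qk orbT.
have [t [ts <- t_pw]] := IHn T C q qk _ (ltnW Nc).
exists ((x, c) :: t); split=> //=.
  by rewrite eqxx (subseq_trans ts) ?filter_subseq.
rewrite t_pw andbT; apply/allP => p pt /=.
have /(mem_subseq ts) : p.1 \in unzip1 t by exact: map_f.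
by rewrite mem_filter => /andP[].
Qed.

(* Every label occurring in an end-homogeneous sequence is read off against its
   last element, so only [k] labels occur. *)
Lemma locally_bounded_ramsey (k n : nat) :
  exists N, forall (T C : eqType) (q : T -> T -> C),
  (forall x s, size (undup [seq q x y | y <- s]) <= k) ->
  (forall y s, size (undup [seq q x y | x <- s]) <= k) ->
  forall s, N <= size s -> exists t c,
    [/\ subseq t s, n <= size t & pairwise (fun x y => q x y == c) t].
Proof.
(* One element is the reference [z]; the other [k * n + 1] carry at most [k] labels, so some label
   occurs more than [n] times. *)
have [N HN] := end_homogeneous k (k * n).+2.
exists N => T C q qk kq s /(HN T C q qk s) [t [ts szt t_pw]].
case/lastP: t => [//|t z] in ts szt t_pw *.
move: szt; rewrite size_rcons => -[szt].
move: t_pw; rewrite pairwise_rcons => /andP[/allP tz t_pw].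
have [||c nc] := @pigeonhole _ _ snd n (undup [seq q x z.1 | x <- unzip1 t]) t.
- move=> p pt; rewrite mem_undup -(eqP (tz p pt)).
  by apply: (map_f (q^~ z.1)); apply: map_f.
- by rewrite szt ltnS leq_mul2r kq orbT.
exists (unzip1 [seq p <- t | p.2 == c]), c; split.
- apply: subseq_trans ts; rewrite /unzip1 map_rcons.
  apply: subseq_trans (subseq_rcons _ _).
  by apply: map_subseq; apply: filter_subseq.
- by rewrite size_map ltnW.
rewrite /unzip1 pairwise_map.
elim: t {ts szt tz nc} t_pw => //= p t IHt /andP[/allP pt /IHt t_pw].
case: ifP => //= /eqP pc; rewrite t_pw andbT; apply/allP => p'.
by rewrite mem_filter => /andP[_ /pt]; rewrite /= pc.
Qed.

Lemma size_undup_pairs (T C D : eqType) (f : T -> C) (g : T -> D) (s : seq T) :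
  size (undup [seq (f x, g x) | x <- s]) <=
  size (undup (map f s)) * size (undup (map g s)).
Proof.
rewrite -(size_allpairs (@pair C D)); apply: uniq_leq_size; first exact: undup_uniq.
move=> p; rewrite mem_undup => /mapP[x xs ->].
by apply: allpairs_f; rewrite mem_undup map_f.
Qed.

Lemma card_eq_seq (T : choiceType) (A : set T) (s : seq T) :
  uniq s -> (forall x, A x <-> x \in s) -> A #= `I_(size s).
Proof.
move=> us As.
have -> : A = [set` seq_fset tt s].
  by apply/funext => x; apply/propext; rewrite As -(seq_fsetE tt).
by apply/card_eq_fsetP; rewrite size_seq_fset undup_id.
Qed.

Lemma card_le_range_seq (T : pointedType) (f : T -> nat) (n : nat) :
  `I_n #<= range f -> exists2 s, size s = n & uniq (map f s).
Proof.
move=> /pcard_leP[g].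
have /choice[h hE] : forall i, exists x, i < n -> f x = g i.
  (* Nothing is required of indices [i >= n], so [point] serves as a default. *)
  move=> i; have [lin|nli] := ltnP i n; last by exists point.
  by have [x _ fx] : range f (g i) by [apply: funS]; exists x.
exists (map h (iota 0 n)); first by rewrite size_map size_iota.
rewrite -map_comp map_inj_in_uniq ?iota_uniq // => i j.
rewrite !mem_iota /= !add0n => lin ljn /=; rewrite !hE // => gij.
by apply: (@inj _ _ _ g) gij; apply/mem_set.
Qed.

Lemma exact_image (f : nat -> nat) (s : seq nat) (m : nat) :
  m <= size (undup (map f s)) -> exists A : set nat, f @` A #= `I_m.
Proof.
move=> ms; pose u := take m (undup (map f s)).
(* The full preimage of [m] chosen colours has exactly these colours as its image. *)
exists [set y | f y \in u].
have <- : size u = m by rewrite size_takel.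
apply: card_eq_seq => [|c]; first by rewrite take_uniq ?undup_uniq.
split=> [[y /= yu <-] //|cu].
have /mapP[y _ cE] : c \in map f s by rewrite -mem_undup (mem_take cu).
by exists y; rewrite //= -cE.
Qed.

Lemma pairwise_mem (T : eqType) (r : rel T) (s : seq T) (x y : T) :
  pairwise r s -> x \in s -> y \in s -> [|| x == y, r x y | r y x].
Proof.
elim: s => //= z s IHs /andP[/allP zs /IHs s_pw]; rewrite !in_cons.
move=> /predU1P[->|xs] /predU1P[->|ys]; rewrite ?eqxx //.
- by rewrite (zs y) ?orbT.
- by rewrite (zs x) ?orbT.
- exact: s_pw.
Qed.

(** Both off-diagonal entries are recorded, so a single Ramsey application to pairs of edges makes
    both triangles of the matrix monochromatic. *)
Definition cross (Delta : nat * nat -> nat) (e e' : nat * nat) : nat * nat :=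
  (Delta (e.1, e'.2), Delta (e'.1, e.2)).

(* The columns of [u] and [v] make both [a] and [b] appear, even when [w] is a
   single edge. *)
Lemma card_homogeneous (Delta : nat * nat -> nat) (a b : nat)
    (u v : nat * nat) (w : seq (nat * nat)) :
  pairwise (fun e e' => cross Delta e e' == (a, b)) (u :: rcons w v) ->
  w != [::] -> uniq (map Delta w) ->
  {in w, forall e, Delta e \notin [:: a; b]} ->
  Delta @` ([set` unzip1 w] `*` [set` unzip2 (u :: rcons w v)])
    #= `I_(size w + size (undup [:: a; b])).
Proof.
move=> w_pw w0 w_uniq wab.
rewrite -(size_map Delta w) -size_cat; apply: card_eq_seq.
  rewrite cat_uniq w_uniq undup_uniq andbT; apply/hasPn => c.
  by rewrite mem_undup => cab; apply/mapP => -[e /wab] /[swap] <-; rewrite cab.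
move=> c; rewrite mem_cat mem_undup; split.
  move=> [[x y] [/mapP[e ew /= ->] yw] <-].
  have {yw} /mapP[e' e'w ->] : y \in unzip2 (u :: rcons w v) by [].
  have ew' : e \in u :: rcons w v by rewrite in_cons mem_rcons in_cons ew !orbT.
  (* Equal positions give a diagonal colour, [e] before [e'] gives [a], and [e] after [e'] gives
     [b]. *)
  have /or3P[/eqP <-|/eqP[-> _]|/eqP[_ ->]] := pairwise_mem _ _ _ _ _ w_pw ew' e'w.
  - by rewrite -surjective_pairing map_f.
  - by rewrite !inE eqxx orbT.
  - by rewrite !inE eqxx !orbT.
have [h hw] : exists h, h \in w.
  by case: (w) w0 => // h ? _; exists h; rewrite mem_head.
move: w_pw; rewrite /= all_rcons pairwise_rcons.
move=> /andP[/andP[_ /allP/(_ h hw)/eqP[_ uh]] /andP[/allP/(_ h hw)/eqP[hv _] _]].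
case/orP => [/mapP[e ew ->]|].
  exists e => //; split; rewrite /= ?map_f //.
  by rewrite in_cons [_ \in map _ _]map_f ?mem_rcons ?in_cons ?ew ?orbT.
rewrite !inE => /orP[]/eqP->.
- exists (h.1, v.2) => //; split; rewrite /= ?map_f //.
  by rewrite in_cons [_ \in map _ _]map_f ?mem_rcons ?mem_head ?orbT.
- by exists (h.1, u.2) => //; split; rewrite /= ?map_f ?mem_head.
Qed.

Theorem theorem5 (m : nat) :
  exists C' : nat, forall Delta : nat * nat -> nat,
    `I_C' #<= range Delta ->
    exists X Y : set nat, Delta @` (X `*` Y) #= `I_m.
Proof.
(* Fewer than [m] colours per row and per column give at most [m * m] values of [cross] from a fixed
   edge. Of the [m + 4] edges, two may be lost to the colours [a] and [b], and two become the end
   edges [u] and [v]. *)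
have [N HN] := locally_bounded_ramsey (m * m) (m + 4).
exists N => Delta /card_le_range_seq[s szs s_uniq].
apply: contrapT => noXY.
have row x r : size (undup [seq Delta (x, y) | y <- r]) < m.
  rewrite ltnNge; apply/negP => /exact_image[A Am]; apply: noXY.
  exists [set x], A; congr (_ #= _): Am; apply/seteqP; split=> c.
    by move=> [y Ay <-]; exists (x, y).
  by move=> [[_ y] /= [-> Ay] <-]; exists y.
have col y r : size (undup [seq Delta (x, y) | x <- r]) < m.
  rewrite ltnNge; apply/negP => /exact_image[A Am]; apply: noXY.
  exists A, [set y]; congr (_ #= _): Am; apply/seteqP; split=> c.
    by move=> [x Ax <-]; exists (x, y).
  by move=> [[x _] /= [Ax ->] <-]; exists x.
have cross_le (f g : nat * nat -> nat) r :
    size (undup (map f r)) < m -> size (undup (map g r)) < m ->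
    size (undup [seq (f e, g e) | e <- r]) <= m * m.
  by move=> fm gm; rewrite (leq_trans (size_undup_pairs _ _ _ _ _ _)) ?leq_mul // ltnW.
have [|||t [[a b] [ts szt t_pw]]] := HN _ _ (cross Delta) _ _ s.
- move=> e r; apply: cross_le.
  + by rewrite (map_comp (fun y => Delta (e.1, y)) snd).
  + by rewrite (map_comp (fun x => Delta (x, e.2)) fst).
- move=> e r; apply: cross_le.
  + by rewrite (map_comp (fun x => Delta (x, e.2)) fst).
  + by rewrite (map_comp (fun y => Delta (e.1, y)) snd).
- by rewrite szs.
have t_uniq := subseq_uniq (map_subseq Delta ts) s_uniq.
pose t' := [seq e <- t | Delta e \notin [:: a; b]].
have t't : subseq t' t by exact: filter_subseq.
have szt' : m + 2 <= size t'.
  have ab2 : count (fun e => Delta e \in [:: a; b]) t <= 2.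
    rewrite -size_filter -(size_map Delta).
    apply: (@uniq_leq_size _ _ [:: a; b]).
      exact: subseq_uniq (map_subseq Delta (filter_subseq _ _)) t_uniq.
    by move=> c /mapP[e]; rewrite mem_filter => /andP[eab _] ->.
  rewrite -(count_predC (fun e => Delta e \in [:: a; b]) t) in szt.
  rewrite /t' size_filter -(leq_add2l 2) addnCA.
  by apply: leq_trans szt _; rewrite leq_add2r.
have t'_uniq := subseq_uniq (map_subseq Delta t't) t_uniq.
have t'_pw := subseq_pairwise t't t_pw.
have t'ab e : e \in t' -> Delta e \notin [:: a; b].
  by rewrite mem_filter => /andP[].
clearbody t'; case: t' => [|u t'] in szt' t'_uniq t'_pw t'ab t't *.
  by rewrite addn2 in szt'.
case/lastP: t' => [|w v] in szt' t'_uniq t'_pw t'ab t't *.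
  by rewrite addn2 in szt'.
have mw : m <= size w by move: szt'; rewrite /= size_rcons addn2.
have wt e : e \in w -> e \in u :: rcons w v.
  by move=> ew; rewrite in_cons mem_rcons in_cons ew !orbT.
have [h hw] : exists h, h \in w.
  case: (w) mw => [|h ?] mw; last by exists h; rewrite mem_head.
  (* On the empty list, [row] says [0 < m]. *)
  by have := leq_trans (row 0 [::]) mw.
(* Row [h.1] meets column [v.2] in colour [a] and column [u.2] in colour [b], so the row bound
   applies to these colours. Hence [k] below is positive and [take k w] is nonempty. *)
have abm : size (undup [:: a; b]) < m.
  apply: leq_ltn_trans (row h.1 [:: v.2; u.2]).
  move: t'_pw; rewrite /= all_rcons pairwise_rcons.
  move=> /andP[/andP[_ /allP/(_ h hw)/eqP[_ ->]] /andP[/allP/(_ h hw)/eqP[-> _] _]].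
  by [].
pose k := m - size (undup [:: a; b]).
have szk : size (take k w) = k by rewrite size_takel // (leq_trans _ mw) ?leq_subr.
have kw : subseq (take k w) w by exact: take_subseq.
apply: noXY; do 2!eexists.
have -> : m = size (take k w) + size (undup [:: a; b]) by rewrite szk subnK // ltnW.
apply: (@card_homogeneous _ a b u v).
- by apply: subseq_pairwise t'_pw; rewrite /= eqxx -!cats1 cat_subseq.
- by rewrite -size_eq0 szk subn_eq0 -ltnNge.
- apply: subseq_uniq t'_uniq; apply: map_subseq.
  rewrite (subseq_trans kw) // (subseq_trans (subseq_rcons w v)) //.
  exact: subseq_cons.
- by move=> e /mem_take /wt /t'ab.
Qed.
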